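(* For any finite multiset $B$ of integers with $|B|<0$ (sum of elements negative), the sweep map is a bijection from $\mathcal D^o_B$ to $\mathcal D^o_B$.
   Context: An incomplete Dyck path of type $B$ is a sequence $(b_1,\dots,b_N)$ with multiset of entries $B$ such that $a:=-(b_1+\cdots+b_N)>0$ and $a+b_1+\cdots+b_i\ge0$ for all $i$. Its $i$-th arrow is the vector $(1,b_i)$ with starting rank $r_i=a+b_1+\cdots+b_{i-1}$ (so $r_1=a$ and the path ends at level $0$). $\mathcal D^o_B$ is the set of incomplete Dyck paths of type $B$. The sweep map sends such a path to the sequence of its steps $b_i$ listed in order of increasing starting rank $0,1,2,\dots$, with arrows of equal starting rank listed from right to left (decreasing $i$). *)

(* Defs.v *)
From mathcomp Require Import all_boot all_order all_algebra.
From mathcomp Require Import finmap multiset.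
From mathcomp Require Import classical_sets functions.

Set Implicit Arguments.
Unset Strict Implicit.
Unset Printing Implicit Defensive.

Import Order.TTheory GRing.Theory Num.Theory.

Local Open Scope classical_set_scope.
Local Open Scope ring_scope.
Local Open Scope mset_scope.

(* The level a at which the path starts, so that it ends at level 0. *)
Definition start_level (p : seq int) : int := - \sum_(b <- p) b.

(* The level a + b_1 + ... + b_i reached after i steps. With positions counted
   from 0 (the k-th arrow sits at position k - 1), this is also the starting
   rank of the arrow at position i: level p i = r_{i+1}. *)
Definition level (p : seq int) (i : nat) : int :=
  start_level p + \sum_(b <- take i p) b.

Definition incomplete_dyck (B : {mset int}) : set (seq int) :=
  [set p | [/\ seq_mset p = B,
               0 < start_level p
             & forall i : nat, (i <= size p)%N -> 0 <= level p i]].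

(* Order in which positions are read: increasing starting rank, and right to
   left (decreasing position) among arrows of equal starting rank. *)
Definition sweep_le (p : seq int) : rel nat :=
  fun i j => (level p i < level p j)
             || ((level p i == level p j) && (j <= i)%N).

Definition sweep (p : seq int) : seq int :=
  [seq nth 0 p i | i <- sort (sweep_le p) (iota 0 (size p))].

(* Main.v *)
(* The sweep map sends a finite set to itself, so it suffices to see that it is
   injective. Let p and q have the same image w, and let x_i and y_i be the
   levels at which the i-th letter of w starts in p and in q. In a path, the
   starting levels together with 0 form the same multiset as the ending levels
   together with the first level a. So the pairs (x_i, y_i) and (0, 0) on the
   one side, (x_i + w_i, y_i + w_i) and (a, a) on the other side, have the same
   first and second components, and also the same sum of squared differences.
   The first family is sorted in both components, hence by the equality case of
   the rearrangement inequality the two families agree as multisets.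
   If x_i - y_i has a positive maximum d, consider the last step of p at which
   it is attained. The pair of levels where this step ends occurs as a pair of
   starting levels, thus d is also attained at the last step of p leaving the
   level just reached, which is a later step. Hence x = y, and the order
   in which ties are read then determines the path. *)

Require Import Defs.
From mathcomp Require Import all_boot all_order all_algebra.
From mathcomp Require Import finmap multiset.
From mathcomp Require Import classical_sets functions.
From mathcomp Require Import boolp zify ring lra.

Set Implicit Arguments.
Unset Strict Implicit.

Import Order.TTheory GRing.Theory Num.Theory.

Local Open Scope ring_scope.
Local Open Scope mset_scope.

(** * Rearrangement inequality with its equality case *)

(** By induction on [T]: its head [t] is minimal in both components, also among the pairs of [P]. If
    [t] occurs in [P] it cancels; otherwise an exchange creates it. *)
Lemma rearrangement_perm (R : realDomainType) (T P : seq (R * R)) :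
    pairwise (fun u v => (u.1 <= v.1) && (u.2 <= v.2)) T ->
    perm_eq (unzip1 P) (unzip1 T) -> perm_eq (unzip2 P) (unzip2 T) ->
  \sum_(u <- P) u.1 * u.2 <= \sum_(u <- T) u.1 * u.2 /\
  (\sum_(u <- P) u.1 * u.2 = \sum_(u <- T) u.1 * u.2 -> perm_eq P T).
Proof.
elim: T P => [|t T IH] P /=.
  by move=> _ /perm_size; rewrite size_map => /size0nil -> _; rewrite big_nil.
case/andP=> /allP tT pwT P1 P2.
have [tP|tP] := boolP (t \in P).
  have permP := perm_to_rem tP; set P' := rem t P in permP.
  have [] := IH P' pwT.
  - by rewrite -(perm_cons t.1) -(permPr P1) perm_sym (perm_map fst permP).
  - by rewrite -(perm_cons t.2) -(permPr P2) perm_sym (perm_map snd permP).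
  move=> le_sum eq_sum; rewrite (perm_big _ permP) /= !big_cons lerD2l.
  split=> // /addrI /eq_sum permT.
  by rewrite (permPl permP) perm_cons.
have min1 u : u \in P -> t.1 <= u.1.
  move=> uP; have : u.1 \in t.1 :: unzip1 T by rewrite -(perm_mem P1) map_f.
  by rewrite inE => /orP[/eqP->//|/mapP[v vT ->]]; case/andP: (tT v vT).
have min2 u : u \in P -> t.2 <= u.2.
  move=> uP; have : u.2 \in t.2 :: unzip2 T by rewrite -(perm_mem P2) map_f.
  by rewrite inE => /orP[/eqP->//|/mapP[v vT ->]]; case/andP: (tT v vT).
have /mapP[u uP tu1] : t.1 \in unzip1 P by rewrite (perm_mem P1) mem_head.
have /mapP[v vP tv2] : t.2 \in unzip2 P by rewrite (perm_mem P2) mem_head.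
have u2 : t.2 < u.2.
  rewrite lt_neqAle min2 // andbT; apply: contra tP => /eqP tu2.
  by rewrite [t]surjective_pairing tu1 tu2 -surjective_pairing.
have v1 : t.1 < v.1.
  rewrite lt_neqAle min1 // andbT; apply: contra tP => /eqP tv1.
  by rewrite [t]surjective_pairing tv1 tv2 -surjective_pairing.
have vrem : v \in rem u P.
  have : v \in u :: rem u P by rewrite -(perm_mem (perm_to_rem uP)).
  by rewrite inE => /orP[/eqP vu|//]; move: u2; rewrite tv2 vu ltxx.
have permP : perm_eq P [:: u, v & rem v (rem u P)].
  by rewrite (permPl (perm_to_rem uP)) perm_cons perm_to_rem.
set P' := rem v (rem u P) in permP.
have [] := IH ((v.1, u.2) :: P') pwT.
- by rewrite -(perm_cons t.1) -(permPr P1) perm_sym tu1 (perm_map fst permP).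
- rewrite -(perm_cons t.2) -(permPr P2) perm_sym (permPl (perm_map snd permP)).
  by rewrite /= tv2 (perm_catCA [:: u.2] [:: v.2]).
(* Exchanging second components turns u, v into t, (v.1, u.2) and strictly
   increases the sum, so the sum over P is not maximal. *)
rewrite (perm_big _ permP) /= !big_cons /= -tu1 -tv2 => le_sum _.
suff lt_sum : t.1 * u.2 + (v.1 * t.2 + \sum_(w <- P') w.1 * w.2)
              < t.1 * t.2 + \sum_(w <- T) w.1 * w.2.
  by split; [exact: ltW | move=> E; rewrite E ltxx in lt_sum].
(* This product is the gain of the exchange. *)
have : 0 < (v.1 - t.1) * (u.2 - t.2) by rewrite mulr_gt0 ?subr_gt0.
by move: le_sum; set S := \sum_(w <- P') _; set S' := \sum_(w <- T) _; lra.
Qed.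

(** * The reading order of the sweep map *)

Definition sweep_order (p : seq int) : seq nat :=
  sort (sweep_le p) (iota 0 (size p)).

Lemma sweep_le_total p : total (sweep_le p).
Proof.
move=> i j; rewrite /sweep_le.
by case: (ltgtP (level p i) (level p j)) => //= _; exact: leq_total.
Qed.

Lemma sweep_le_trans p : transitive (sweep_le p).
Proof.
move=> j i k; rewrite /sweep_le => /orP[ij|/andP[/eqP-> ij]].
  by case/orP=> [jk|/andP[/eqP<- _]]; rewrite ?ij // (lt_trans ij jk).
by case/orP=> [->//|/andP[-> jk]]; rewrite (leq_trans jk ij) orbT.
Qed.

Lemma sweep_le_level p i j : sweep_le p i j -> level p i <= level p j.
Proof. by case/orP=> [/ltW//|/andP[/eqP->]]. Qed.

Lemma perm_sweep_order p : perm_eq (sweep_order p) (iota 0 (size p)).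
Proof. by rewrite perm_sort. Qed.

Lemma size_sweep_order p : size (sweep_order p) = size p.
Proof. by rewrite size_sort size_iota. Qed.

Lemma size_sweep p : size (sweep p) = size p.
Proof. by rewrite size_map size_sweep_order. Qed.

Lemma sweep_order_uniq p : uniq (sweep_order p).
Proof. by rewrite sort_uniq iota_uniq. Qed.

Lemma mem_sweep_order p i : (i \in sweep_order p) = (i < size p)%N.
Proof. by rewrite (perm_mem (perm_sweep_order p)) mem_iota add0n. Qed.

Lemma nth_sweep_order_lt p i :
  (i < size p)%N -> (nth 0 (sweep_order p) i < size p)%N.
Proof. by move=> ip; rewrite -mem_sweep_order mem_nth ?size_sweep_order. Qed.

Lemma nth_sweep p i : (i < size p)%N ->
  nth 0 (sweep p) i = nth 0 p (nth 0%N (sweep_order p) i).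
Proof. by move=> ip; rewrite (nth_map 0%N) ?size_sweep_order. Qed.

Lemma sweep_order_sorted p i j : (i <= j)%N -> (j < size p)%N ->
  sweep_le p (nth 0%N (sweep_order p) i) (nth 0%N (sweep_order p) j).
Proof.
move=> ij jp; apply: sorted_leq_nth => //; rewrite ?inE ?size_sweep_order //.
- exact: sweep_le_trans.
- by move=> k; rewrite /sweep_le eqxx leqnn orbT.
- exact/sort_sorted/sweep_le_total.
- exact: leq_ltn_trans jp.
Qed.

Lemma sweep_order_level p i j : (i <= j)%N -> (j < size p)%N ->
  level p (nth 0%N (sweep_order p) i) <= level p (nth 0%N (sweep_order p) j).
Proof. by move=> ij jp; apply/sweep_le_level/sweep_order_sorted. Qed.

Lemma sweep_order_tie p i j : (i < j)%N -> (j < size p)%N ->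
  level p (nth 0%N (sweep_order p) i) = level p (nth 0%N (sweep_order p) j) ->
  (nth 0 (sweep_order p) j < nth 0 (sweep_order p) i)%N.
Proof.
move=> ij jp eq_lev; have := sweep_order_sorted (ltnW ij) jp.
rewrite /sweep_le eq_lev ltxx eqxx /= leq_eqVlt => /orP[/eqP|//].
move/eqP; rewrite nth_uniq ?sweep_order_uniq ?size_sweep_order //.
  by rewrite gtn_eqF.
exact: ltn_trans jp.
Qed.

(** * Stability of incomplete Dyck paths under the sweep map *)

Lemma perm_sweep p : perm_eq (sweep p) p.
Proof.
rewrite (permPl (perm_map _ (perm_sweep_order p))).
by rewrite -[X in perm_eq _ X](mkseq_nth 0).
Qed.

Lemma start_level_sweep p : start_level (sweep p) = start_level p.
Proof. by rewrite /start_level (perm_big _ (perm_sweep p)). Qed.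

Lemma level0 p : level p 0 = start_level p.
Proof. by rewrite /level take0 big_nil addr0. Qed.

Lemma level_size p : level p (size p) = 0.
Proof. by rewrite /level take_size addNr. Qed.

Lemma levelS p i : (i < size p)%N -> level p i.+1 = level p i + nth 0 p i.
Proof.
by move=> ip; rewrite /level (take_nth 0) // -cats1 big_cat big_seq1 addrA.
Qed.

(* The steps that are not yet read after n letters of the sweep start at level
   at least K, those already read start at level at most K. The potential g
   telescopes along each maximal run of unread steps. *)
Lemma sweep_level_ge0 (p : seq int) (n : nat) :
  (forall i, (i <= size p)%N -> 0 <= level p i) ->
  (n <= size p)%N -> 0 <= level (sweep p) n.
Proof.
move=> lev0; rewrite leq_eqVlt => /orP[/eqP->|np].
  by rewrite -size_sweep level_size.
set s := sweep_order p; pose K := level p (nth 0%N s n).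
pose J := drop n s.
have K0 : 0 <= K by apply/lev0/ltnW/nth_sweep_order_lt.
have JK i : i \in J -> K <= level p i.
  case/(nthP 0%N)=> k; rewrite size_drop size_sweep_order => kn <-.
  by rewrite nth_drop sweep_order_level ?leq_addr //; lia.
have nJK i : (i <= size p)%N -> i \notin J -> level p i <= K.
  (* The end vertex is not the start of any step; there the bound is [K0]. *)
  rewrite leq_eqVlt => /orP[/eqP->|ip]; first by rewrite level_size.
  have : i \in take n s ++ J by rewrite cat_take_drop mem_sweep_order.
  rewrite mem_cat => /orP[|->//] /(nthP 0%N)[k].
  rewrite size_take size_sweep_order np => kn <- _.
  by rewrite nth_take // sweep_order_level // ltnW.
pose g (i : nat) : int := if i \in J then level p i - K else 0.
have gN : g (size p) = 0.
  rewrite /g; case: ifP => // /mem_drop.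
  by rewrite mem_sweep_order ltnn.
have g0 : 0 <= g 0%N by rewrite /g; case: ifP => // /JK; lia.
have uniqJ : uniq J by rewrite drop_uniq ?sweep_order_uniq.
have -> : level (sweep p) n = - \sum_(i <- J) nth 0 p i.
  rewrite /level start_level_sweep /start_level.
  rewrite -(perm_big _ (perm_sweep p)) -{1}(cat_take_drop n (sweep p)) big_cat.
  by rewrite /= opprD addrC addrA addrN add0r /sweep -map_drop big_map.
have -> : \sum_(i <- J) nth 0 p i = \sum_(0 <= i < size p | i \in J) nth 0 p i.
  rewrite -[RHS]big_filter; apply: perm_big; apply: uniq_perm => //.
    by rewrite filter_uniq ?iota_uniq.
  move=> i; rewrite mem_filter mem_index_iota /=.
  by case iJ: (i \in J) => //=; rewrite -mem_sweep_order (mem_drop iJ).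
apply: le_trans g0 _.
have -> : g 0%N = - (g (size p) - g 0%N) by rewrite gN sub0r opprK.
rewrite lerN2 -(telescope_sumr g) // [leLHS]big_mkcond.
(* Termwise, [g] grows by exactly the step inside an unread run; [nJK] bounds the step leaving a
   run, and [JK] the one entering it. *)
apply: ler_sum_nat => i /andP[_ ip]; rewrite /g.
have lev : nth 0 p i = level p i.+1 - level p i by rewrite levelS // addrC addKr.
have := JK i; have := JK i.+1; have := nJK i.+1 ip; have := nJK i (ltnW ip).
by case: (i \in J); case: (i.+1 \in J) => /= *; rewrite ?lev; lia.
Qed.

(** * Injectivity of the sweep map *)

Definition sweep_level (p : seq int) (i : nat) : int :=
  level p (nth 0%N (sweep_order p) i).

(** Both sides list the levels of all vertices of the path: every vertex but the first ends a step,
    every vertex but the last starts one. *)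
Lemma perm_sweep_level (p : seq int) :
  perm_eq (start_level p ::
             [seq sweep_level p i + nth 0 (sweep p) i | i <- iota 0 (size p)])
          (0 :: [seq sweep_level p i | i <- iota 0 (size p)]).
Proof.
have reindex (f : nat -> int) :
    perm_eq [seq f (nth 0%N (sweep_order p) i) | i <- iota 0 (size p)]
            [seq f i | i <- iota 0 (size p)].
  rewrite (map_comp f (nth 0%N (sweep_order p))); apply: perm_map.
  by rewrite -{1}size_sweep_order map_nth_iota0 // take_size perm_sweep_order.
have levels : perm_eq (0 :: [seq sweep_level p i | i <- iota 0 (size p)])
                      (mkseq (level p) (size p).+1).
  rewrite mkseqS level_size -cats1 perm_sym perm_catC perm_cons perm_sym.
  exact: reindex.
rewrite (permPr levels) /mkseq /= level0 perm_cons (iotaDl 1 0) -map_comp.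
rewrite (eq_in_map _ (fun i => level p (nth 0%N (sweep_order p) i).+1) _).1.
  exact: (reindex (level p \o succn)).
move=> i; rewrite mem_iota add0n /= => ip.
by rewrite nth_sweep // -levelS // nth_sweep_order_lt.
Qed.

(** One-sided because the argument takes a maximal difference; exchanging [p] and [q] gives
    equality. *)
Lemma sweep_level_le (p q : seq int) :
  (forall i, (i <= size p)%N -> 0 <= level p i) ->
  (forall i, (i <= size q)%N -> 0 <= level q i) ->
  sweep p = sweep q ->
  forall i, (i < size p)%N -> sweep_level p i <= sweep_level q i.
Proof.
move=> p0 q0 eq_sw.
have sz : size q = size p by rewrite -size_sweep -eq_sw size_sweep.
have st : start_level q = start_level p.
  by rewrite -start_level_sweep -eq_sw start_level_sweep.
pose x := sweep_level p; pose y := sweep_level q; pose w := nth 0 (sweep p).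
pose I := iota 0 (size p).
have x0 i : (i < size p)%N -> 0 <= x i.
  by move=> ip; apply/p0/ltnW/nth_sweep_order_lt.
have y0 i : (i < size p)%N -> 0 <= y i.
  by move=> ip; apply/q0/ltnW/nth_sweep_order_lt; rewrite sz.
pose T := (0, 0) :: [seq (x i, y i) | i <- I].
pose P := (start_level p, start_level p) :: [seq (x i + w i, y i + w i) | i <- I].
have permPT : perm_eq P T.
  have pwT : pairwise (fun u v : int * int => (u.1 <= v.1) && (u.2 <= v.2)) T.
    rewrite /T /=; apply/andP; split.
      apply/allP=> _ /mapP[i iI ->] /=; move: iI; rewrite mem_iota add0n /= => ip.
      by rewrite x0 ?y0.
    apply/(pairwiseP (0, 0)) => i j; rewrite !inE size_map size_iota => ip jp ij.
    rewrite !(nth_map 0%N) ?size_iota // !nth_iota // !add0n.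
    by rewrite !sweep_order_level ?sz // ltnW.
  have P1 : perm_eq (unzip1 P) (unzip1 T).
    by rewrite /= /unzip1 -!map_comp; exact: perm_sweep_level.
  have P2 : perm_eq (unzip2 P) (unzip2 T).
    rewrite /= /unzip2 -!map_comp.
    by have := perm_sweep_level q; rewrite st sz -eq_sw.
  have [_] := rearrangement_perm pwT P1 P2; apply.
  (* Polarisation: squares agree by [P1] and [P2], squared differences because both levels shift by
     [w i], so the sums of products agree. *)
  have sq1 : \sum_(u <- P) u.1 * u.1 = \sum_(u <- T) u.1 * u.1.
    by rewrite -(big_map fst xpredT (fun z => z * z)) (perm_big _ P1) big_map.
  have sq2 : \sum_(u <- P) u.2 * u.2 = \sum_(u <- T) u.2 * u.2.
    by rewrite -(big_map snd xpredT (fun z => z * z)) (perm_big _ P2) big_map.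
  have sqB : \sum_(u <- P) (u.1 - u.2) * (u.1 - u.2)
           = \sum_(u <- T) (u.1 - u.2) * (u.1 - u.2).
    rewrite !big_cons !big_map /= !subrr; congr (_ + _).
    by apply: eq_bigr => i _; ring.
  have split_sq (S : seq (int * int)) : \sum_(u <- S) (u.1 - u.2) * (u.1 - u.2) =
      \sum_(u <- S) u.1 * u.1 + \sum_(u <- S) u.2 * u.2
      - 2 * \sum_(u <- S) u.1 * u.2.
    rewrite mulr_sumr -sumrN -!big_split /=.
    by apply: eq_bigr => u _; ring.
  by move: sqB; rewrite !split_sq sq1 sq2 => /addrI /oppr_inj /mulfI; exact.
move=> i0 i0p; rewrite leNgt; apply/negP => lt0.
pose D (i : 'I_(size p)) := x i - y i.
have [i1 _ max1] := @arg_maxP _ _ _ (Ordinal i0p) xpredT D isT.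
have d0 : 0 < D i1.
  by apply: lt_le_trans (max1 (Ordinal i0p) isT); rewrite subr_gt0.
have [i /eqP Di maxi] := @arg_maxnP _ i1 (fun i => D i == D i1)
  (fun i => nth 0%N (sweep_order p) i) (eqxx _).
set n := nth 0%N (sweep_order p) i in maxi.
have np : (n < size p)%N by exact: nth_sweep_order_lt.
have lev_next : level p n.+1 = x i + w i.
  by rewrite levelS // /w nth_sweep.
have : (x i + w i, y i + w i) \in T.
  rewrite -(perm_mem permPT) inE; apply/orP; right; apply/mapP.
  by exists (nat_of_ord i); rewrite // mem_iota /=.
rewrite inE => /orP[/eqP[xw yw]|]; first by rewrite -Di /D in d0; lia.
case/mapP=> k; rewrite mem_iota add0n /= => kp [xk yk].
have Dk : D (Ordinal kp) = D i1 by rewrite -Di /D /= -xk -yk; lia.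
have := maxi (Ordinal kp); rewrite Dk eqxx => /(_ isT) /= kn.
(* If [n] is the last position, then [x k] is 0 and a positive difference makes [y k] negative. *)
move: np; rewrite leq_eqVlt => /orP[/eqP nN|n1p].
  have := y0 k kp; rewrite -yk; move: lev_next; rewrite nN level_size.
  by rewrite -Di /D in d0; lia.
(* The step after [n] starts at the same level as [k] but further right, so it is read no later than
   [k]. Hence [y j <= y k], and [j] is a maximiser beyond [n]. *)
pose j := index n.+1 (sweep_order p).
have jp : (j < size p)%N by rewrite -size_sweep_order index_mem mem_sweep_order.
have sj : nth 0%N (sweep_order p) j = n.+1 by rewrite nth_index ?mem_sweep_order.
have xj : x j = x k by rewrite /x /sweep_level sj lev_next xk.
have jk : (j <= k)%N.
  rewrite leqNgt; apply/negP => kj.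
  have := sweep_order_tie kj jp (esym xj); rewrite sj; lia.
have yjk : y j <= y k by apply: sweep_order_level; rewrite ?sz.
have Dj : D (Ordinal jp) == D i1.
  by rewrite eq_le [D _ <= D i1]max1 //= -Dk /D /= xj lerD2l lerN2.
by have := maxi _ Dj; rewrite /= sj ltnn.
Qed.

(** Strong induction shows that each position [n] has the same reading index in both paths. If not,
    the tie rule puts some [m < n] of one path at the index that [n] has in the other, against the
    induction hypothesis for [m]. *)
Lemma sweep_inj (p q : seq int) :
  (forall i, (i <= size p)%N -> 0 <= level p i) ->
  (forall i, (i <= size q)%N -> 0 <= level q i) ->
  sweep p = sweep q -> p = q.
Proof.
move=> p0 q0 eq_sw.
have sz : size q = size p by rewrite -size_sweep -eq_sw size_sweep.
have st : start_level q = start_level p.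
  by rewrite -start_level_sweep -eq_sw start_level_sweep.
have eq_lev i : (i < size p)%N -> sweep_level p i = sweep_level q i.
  move=> ip; have iq : (i < size q)%N by rewrite sz.
  apply/eqP; rewrite eq_le (sweep_level_le p0 q0 eq_sw ip).
  exact: (sweep_level_le q0 p0 (esym eq_sw) iq).
pose ip n := index n (sweep_order p); pose iq n := index n (sweep_order q).
have ipK n : (n < size p)%N -> nth 0%N (sweep_order p) (ip n) = n.
  by move=> ?; rewrite nth_index ?mem_sweep_order.
have iqK n : (n < size p)%N -> nth 0%N (sweep_order q) (iq n) = n.
  by move=> ?; rewrite nth_index ?mem_sweep_order ?sz.
have ip_lt n : (n < size p)%N -> (ip n < size p)%N.
  by move=> ?; rewrite -[ltnRHS]size_sweep_order index_mem mem_sweep_order.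
have iq_lt n : (n < size p)%N -> (iq n < size p)%N.
  by move=> ?; rewrite -sz -[ltnRHS]size_sweep_order index_mem mem_sweep_order sz.
have step n : (n < size p)%N -> ip n = iq n -> nth 0 p n = nth 0 q n.
  move=> np eqn; rewrite -{1}(ipK n np) -nth_sweep ?ip_lt // eq_sw eqn.
  by rewrite nth_sweep ?iqK ?sz ?iq_lt.
have eq_index n : (n < size p)%N -> ip n = iq n.
  elim/ltn_ind: n => n IH np.
  have levn m : (m <= n)%N -> level p m = level q m.
    elim: m => [|m IHm] mn; first by rewrite !level0.
    have mp : (m < size p)%N by exact: ltn_trans np.
    by rewrite !levelS ?sz // IHm ?step ?IH // ltnW.
  have lev_ip : sweep_level p (ip n) = level p n by rewrite /sweep_level ipK.
  have lev_iq : sweep_level q (iq n) = level p n.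
    by rewrite /sweep_level iqK // levn.
  case: (ltngtP (ip n) (iq n)) => // lt_i.
    have := @sweep_order_tie p _ _ lt_i (iq_lt n np).
    rewrite -/(sweep_level p _) -/(sweep_level p _) lev_ip eq_lev ?iq_lt // lev_iq.
    rewrite ipK // => /(_ erefl); set m := nth _ _ _ => mn.
    have mp : (m < size p)%N by exact: ltn_trans np.
    have ipm : ip m = iq n.
      by rewrite /ip /m index_uniq ?sweep_order_uniq // size_sweep_order iq_lt.
    have := iqK m mp; rewrite -IH // ipm iqK // => nm.
    by rewrite nm ltnn in mn.
  have jq : (ip n < size q)%N by rewrite sz ip_lt.
  have := @sweep_order_tie q _ _ lt_i jq.
  rewrite -/(sweep_level q _) -/(sweep_level q _) lev_iq -eq_lev ?ip_lt // lev_ip.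
  rewrite iqK // => /(_ erefl); set m := nth _ _ _ => mn.
  have mp : (m < size p)%N by exact: ltn_trans np.
  have iqm : iq m = ip n.
    by rewrite /iq /m index_uniq ?sweep_order_uniq // size_sweep_order.
  have := ipK m mp; rewrite IH // iqm ipK // => nm.
  by rewrite nm ltnn in mn.
by apply: (@eq_from_nth _ 0) => // n np; apply/step/eq_index.
Qed.

(** * Bijectivity by counting *)

Theorem theorem3 (B : {mset int}) (hB : \sum_(b <- B) b < 0) :
  set_bij (incomplete_dyck B) (incomplete_dyck B) sweep.
Proof.
have stable p : incomplete_dyck B p -> incomplete_dyck B (sweep p).
  case=> pB p_start p0; split.
  - by rewrite -pB; apply/eq_seq_msetP; exact: perm_sweep.
  - by rewrite start_level_sweep.
  - by move=> i; rewrite size_sweep; exact: sweep_level_ge0.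
have inj p q : incomplete_dyck B p -> incomplete_dyck B q ->
    sweep p = sweep q -> p = q.
  by case=> _ _ p0 [_ _ q0]; exact: sweep_inj.
(* Paths of type [B] are permutations of [B], so [D] lists them all and surjectivity reduces to
   comparing lengths. *)
pose D := [seq p <- permutations B | `[< incomplete_dyck B p >]].
have memD p : (p \in D) = `[< incomplete_dyck B p >].
  rewrite mem_filter; case: asboolP => //= -[pB _ _].
  by rewrite mem_permutations; apply/eq_seq_msetP; rewrite pB seq_mset_id.
have uniqD : uniq D by rewrite filter_uniq ?permutations_uniq.
split=> //.
- by move=> p q; rewrite !inE; exact: inj.
- move=> q Dq.
  have uniqS : uniq (map sweep D).
    rewrite map_inj_in_uniq // => p1 p2; rewrite !memD => /asboolP D1 /asboolP D2.
    exact: inj.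
  have subS : {subset map sweep D <= D}.
    by move=> _ /mapP[p + ->]; rewrite !memD => /asboolP /stable /asboolP.
  have [|_ eqS] := uniq_min_size uniqS subS; first by rewrite size_map.
  have : q \in map sweep D by rewrite eqS memD; apply/asboolP.
  by case/mapP=> p; rewrite memD => /asboolP Dp ->; exists p.
Qed.
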